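(* Let $T$ be a weighted 3-cycle (with positive edge weights), let $0<\lambda_1\leq\lambda_2$ be the positive eigenvalues (counted with multiplicity) of the Laplace operator associated with $T$, and let $\rho(T)$ be the global resistance of $T$. Then $$\lambda_1\,\rho(T)\leq 6\leq \lambda_2\,\rho(T).$$ In each of the two inequalities, equality occurs if and only if the three weights are all equal to each other.
   Context: A weighted 3-cycle $T$ is the cycle graph on vertices $v_0,v_1,v_2$ (each pair of distinct vertices is joined by an edge) with weights (conductances) $c_{i,j}=c_{j,i}>0$ on the edge joining $v_i$ and $v_j$, $i\neq j$; set $c_{i,i}=0$. Let $\ell(T)$ be the space of real-valued functions on the vertices, with inner product $\langle f,g\rangle=\sum_j f(v_j)g(v_j)$. The Laplacian on $T$ is the linear operator on $\ell(T)$ given by $(\Delta f)(v_k)=\sum_{j} c_{j,k}\,(f(v_k)-f(v_j))$. It is self-adjoint and non-negative, with eigenvalues $0=\lambda_0<\lambda_1\le\lambda_2$. The energy of $f$ is $E(f)=\langle\Delta f,f\rangle=\sum_{i<j}c_{i,j}(f(v_i)-f(v_j))^2$. For distinct vertices $v_i,v_j$, the effective resistance metric is $d_{\rm r}(v_i,v_j)=1/m$, where $m=\min\{E(f) : f\in\ell(T),\ f(v_i)=1,\ f(v_j)=0\}$. The global resistance is $\rho(T)=\sum d_{\rm r}(v_i,v_j)$, the sum being over all unordered pairs of adjacent vertices (here, all three pairs). *)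

(* Defs.v *)
From HB Require Import structures.
From mathcomp Require Import all_boot all_order all_algebra.
From mathcomp Require Import boolp classical_sets reals.

Set Implicit Arguments.
Unset Strict Implicit.
Unset Printing Implicit Defensive.

Import Order.TTheory GRing.Theory Num.Theory.

Local Open Scope ring_scope.
Local Open Scope classical_set_scope.

Record weighted_3cycle (R : realType) := Weighted3Cycle {
  weight :> 'I_3 -> 'I_3 -> R;
  weight_sym : forall i j, weight i j = weight j i;
  weight_diag : forall i, weight i i = 0;
  weight_gt0 : forall i j, i != j -> 0 < weight i j }.

(* The codomain is R^o so that functions form a vector space over R. *)
Definition ell (R : realType) := {ffun 'I_3 -> R^o}.

Definition inner (R : realType) (f g : ell R) : R := \sum_j f j * g j.

Definition lap_fun (R : realType) (c : weighted_3cycle R) (f : ell R) : ell R :=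
  [ffun k => \sum_j c j k * (f k - f j)].

Lemma lap_fun_is_linear (R : realType) (c : weighted_3cycle R) :
  linear (lap_fun c).
Proof.
move=> a f g; apply/ffunP => k; rewrite !ffunE scaler_sumr -big_split.
apply: eq_bigr => j _ /=; rewrite !ffunE /GRing.scale /=.
by rewrite (mulrCA a) -mulrDr (mulrBr a) opprD addrACA.
Qed.

HB.instance Definition _ (R : realType) (c : weighted_3cycle R) :=
  GRing.isLinear.Build R (ell R) (ell R) _ (lap_fun c) (lap_fun_is_linear c).

Definition laplacian (R : realType) (c : weighted_3cycle R) : 'End(ell R) :=
  linfun (lap_fun c).

Definition energy (R : realType) (c : weighted_3cycle R) (f : ell R) : R :=
  inner (laplacian c f) f.

(* The least element of A; the value 0 is a placeholder used only when A has
   no least element. *)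
Definition minimum (R : realType) (A : set R) : R :=
  xget 0 [set m | A m /\ lbound A m].

Definition eff_resistance (R : realType) (c : weighted_3cycle R) (i j : 'I_3) : R :=
  1 / minimum [set energy c f | f in [set f : ell R | f i = 1 /\ f j = 0]].

Definition global_resistance (R : realType) (c : weighted_3cycle R) : R :=
  \sum_(i < 3) \sum_(j < 3 | (i < j)%N) eff_resistance c i j.

Definition multiplicity (R : realType) (c : weighted_3cycle R) (a : R) : nat :=
  \dim (passmx.leigenspace (laplacian c) a).

Definition equal_weights (R : realType) (c : weighted_3cycle R) : Prop :=
  forall i j k l : 'I_3, i != j -> k != l -> c i j = c k l.

(* Main.v *)
Require Import Defs.
From HB Require Import structures.
From mathcomp Require Import all_boot all_order all_algebra.
From mathcomp Require Import boolp classical_sets reals.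
From mathcomp Require Import ring lra.

Set Implicit Arguments.
Unset Strict Implicit.
Unset Printing Implicit Defensive.

Import Order.TTheory GRing.Theory Num.Theory.

Local Open Scope ring_scope.

(** Write [S] for the sum of the three weights and [P] for the sum of their
    pairwise products.  Everything is expressed through [S] and [P].

    On the spectral side, the characteristic polynomial of the Laplacian is
    [t * (t ^ 2 - 2 S t + 3 P)], so the positive eigenvalues satisfy
    [l1 + l2 = 2 S] and [l1 * l2 = 3 P] (lemmas [multiplicity_gt0] and
    [vieta_of_pos_roots]).  Only the set of positive eigenvalues is needed: when
    [l1 = l2], that set being a singleton forces the quadratic to have a double
    root, so the dimension of the eigenspace plays no role.

    On the metric side, minimizing the energy at the third vertex is the
    series-parallel law, [d(i, j) = (c_ik + c_jk) / P], whence [rho = 2 S / P]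
    (lemma [global_resistanceE]).

    Eliminating [S] and [P] gives [rho = 3 (1 / l1 + 1 / l2)].  Thus
    [l1 * rho = 3 (1 + l1 / l2) <= 6 <= 3 (1 + l2 / l1) = l2 * rho], with
    equality on either side iff [l1 = l2].  Finally
    [(l1 - l2) ^ 2 = 4 (S ^ 2 - 3 P)] is twice the sum of the squared
    differences of the weights, which vanishes iff the weights agree. *)

(** * Laplacian and energy in coordinates *)

(** A sum over the vertices, listed in any order. *)
Lemma sum_vertices (V : nmodType) (i j k : 'I_3) (F : 'I_3 -> V) :
  uniq [:: i; j; k] -> \sum_x F x = F i + F j + F k.
Proof.
move=> u; have full x : x \in [:: i; j; k].
  have sub : {subset [:: i; j; k] <= enum 'I_3} by move=> y _; rewrite mem_enum.
  have [|_ ->] := uniq_min_size u sub; first by rewrite size_enum_ord.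
  by rewrite mem_enum.
rewrite (eq_bigl (fun x => x \in [:: i; j; k])); last by move=> x; rewrite full.
by rewrite -big_uniq //= !big_cons big_nil addr0 addrA.
Qed.

Lemma laplacianE (R : realType) (T : weighted_3cycle R) (f : ell R)
    (i j k : 'I_3) : uniq [:: i; j; k] ->
  laplacian T f i = T i j * (f i - f j) + T i k * (f i - f k) :> R.
Proof.
move=> u; rewrite lfunE /= ffunE (sum_vertices _ u) weight_diag mul0r add0r.
by rewrite (weight_sym T j) (weight_sym T k).
Qed.

Lemma energyE (R : realType) (T : weighted_3cycle R) (f : ell R)
    (i j k : 'I_3) : uniq [:: i; j; k] ->
  energy T f = T i j * (f i - f j) ^+ 2 + T i k * (f i - f k) ^+ 2
             + T j k * (f j - f k) ^+ 2 :> R.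
Proof.
move=> u; have u' : uniq [:: j; i; k].
  move: u; rewrite /= !inE !negb_or (eq_sym j i) andbT.
  by move=> /andP[/andP[-> ->] ->].
have u'' : uniq [:: k; i; j] by rewrite (rot_uniq 2 [:: i; j; k]).
rewrite /energy /inner (sum_vertices _ u).
rewrite (laplacianE T f u) (laplacianE T f u') (laplacianE T f u'').
rewrite (weight_sym T j i) (weight_sym T k i) (weight_sym T k j).
move: (f i : R) (f j : R) (f k : R) => x y z; ring.
Qed.

(** * Effective and global resistance *)

Lemma minimumP (R : realType) (A : set R) (m : R) :
  A m -> lbound A m -> minimum A = m.
Proof.
move=> Am lbm; apply: xget_unique => [//|y [Ay lby]].
by apply/le_anti; rewrite lby //= lbm.
Qed.

(** The series-parallel law: the direct edge is in parallel with the path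
    through the third vertex. *)
Lemma eff_resistanceE (R : realType) (T : weighted_3cycle R)
    (i j k : 'I_3) : uniq [:: i; j; k] ->
  eff_resistance T i j
  = (T i k + T j k) / (T i j * T i k + T i j * T j k + T i k * T j k).
Proof.
move=> u; have [nij nik njk] : [/\ i != j, i != k & j != k].
  by move: u; rewrite /= !inE negb_or andbT => /andP[/andP[-> ->]->].
have a0 := weight_gt0 T nij; have b0 := weight_gt0 T nik.
have c0 := weight_gt0 T njk.
set a := T i j in a0 *; set b := T i k in b0 *; set c := T j k in c0 *.
have bc0 : b + c != 0 by rewrite gt_eqF ?addr_gt0.
have P0 : a * b + a * c + b * c != 0 by rewrite gt_eqF ?addr_gt0 ?mulr_gt0.
rewrite /eff_resistance (@minimumP _ _ (a + b * c / (b + c))).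
- by field; rewrite P0.
- (* The minimizer takes at the third vertex the weighted mean of 1 and 0. *)
  exists [ffun x => if x == i then 1 else if x == j then 0 else b / (b + c)].
    by rewrite /= !ffunE !eqxx eq_sym (negPf nij).
  rewrite (energyE T _ u) !ffunE !eqxx [j == i]eq_sym (negPf nij).
  rewrite [k == i]eq_sym (negPf nik) [k == j]eq_sym (negPf njk).
  by rewrite -/a -/b -/c; field.
- move=> _ [f [fi fj] <-]; rewrite (energyE T f u) fi fj -/a -/b -/c.
  move: (f k : R) => z; rewrite -subr_ge0.
  rewrite (_ : _ - _ = ((b + c) * z - b) ^+ 2 / (b + c)); last by field.
  by rewrite divr_ge0 ?sqr_ge0 ?ltW ?addr_gt0.
Qed.

(** The sum of the three weights. *)
Definition weight_sum (R : realType) (T : weighted_3cycle R) : R :=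
  T 0 1 + T 0 2 + T 1 2.

(** The sum of the pairwise products of the weights, i.e. the weighted number
    of spanning trees of the cycle. *)
Definition weight_sum2 (R : realType) (T : weighted_3cycle R) : R :=
  T 0 1 * T 0 2 + T 0 1 * T 1 2 + T 0 2 * T 1 2.

Lemma weight_sum_gt0 (R : realType) (T : weighted_3cycle R) :
  0 < weight_sum T.
Proof. by rewrite !addr_gt0 ?weight_gt0. Qed.

Lemma weight_sum2_gt0 (R : realType) (T : weighted_3cycle R) :
  0 < weight_sum2 T.
Proof. by rewrite !addr_gt0 ?mulr_gt0 ?weight_gt0. Qed.

Lemma weight_discriminant (R : realType) (T : weighted_3cycle R) :
  2 * (weight_sum T ^+ 2 - 3 * weight_sum2 T)
  = (T 0 1 - T 0 2) ^+ 2 + (T 0 1 - T 1 2) ^+ 2 + (T 0 2 - T 1 2) ^+ 2.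
Proof. by rewrite /weight_sum /weight_sum2; ring. Qed.

Lemma weight_discriminant_ge0 (R : realType) (T : weighted_3cycle R) :
  3 * weight_sum2 T <= weight_sum T ^+ 2.
Proof.
rewrite -subr_ge0 -(@pmulr_rge0 _ 2) // weight_discriminant.
by rewrite !addr_ge0 ?sqr_ge0.
Qed.

Lemma equal_weightsP (R : realType) (T : weighted_3cycle R) :
  equal_weights T <-> weight_sum T ^+ 2 = 3 * weight_sum2 T.
Proof.
have disc := weight_discriminant T; split=> [eqT|/eqP].
  by move: disc; rewrite (eqT 0 2 0 1) // (eqT 1 2 0 1) // => disc; lra.
rewrite -subr_eq0 => /eqP D0; move: disc; rewrite D0 mulr0 => /esym/eqP.
rewrite !paddr_eq0 ?addr_ge0 ?sqr_ge0 // !sqrf_eq0 !subr_eq0.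
case/andP=> /andP[/eqP e02 /eqP e12] _.
have eqT i j : i != j -> T i j = T 0 1.
  have ord3 (x : 'I_3) : [\/ x = 0, x = 1 | x = 2].
    case: x => [[|[|[|//]]] lt_x3]; [apply: Or31|apply: Or32|apply: Or33];
      exact: val_inj.
  by case: (ord3 i) => ->; case: (ord3 j) => -> //; rewrite // weight_sym.
by move=> i j k l nij nkl; rewrite (eqT i j) // (eqT k l).
Qed.

Lemma global_resistanceE (R : realType) (T : weighted_3cycle R) :
  global_resistance T = 2 * weight_sum T / weight_sum2 T.
Proof.
have V (F : 'I_3 -> R) : \sum_x F x = F 0 + F 1 + F 2 by exact: sum_vertices.
have P0 : weight_sum2 T != 0 by rewrite gt_eqF ?weight_sum2_gt0.
rewrite /global_resistance V !(big_mkcond (fun j : 'I_3 => (_ < j)%N)) /= !V /=.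
rewrite !(add0r, addr0).
rewrite (@eff_resistanceE _ T 0 1 2) // (@eff_resistanceE _ T 0 2 1) //.
rewrite (@eff_resistanceE _ T 1 2 0) // (weight_sym T 2 1).
rewrite (weight_sym T 1 0) (weight_sym T 2 0).
move: P0; rewrite /weight_sum /weight_sum2.
move: (T 0 1) (T 0 2) (T 1 2) => a b c P0.
by field.
Qed.

(** * Positive eigenvalues *)

Lemma multiplicity_gt0_eigenvector (R : realType) (T : weighted_3cycle R)
    (t : R) :
  (0 < multiplicity T t)%N <-> exists2 f, f != 0 & laplacian T f = t *: f.
Proof.
have eigP f : f \in passmx.leigenspace (laplacian T) t <->
    laplacian T f = t *: f.
  rewrite memv_ker add_lfunE opp_lfunE scale_lfunE id_lfunE subr_eq0.
  by split=> /eqP.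
rewrite lt0n dimv_eq0 -vpick0; split=> [nz|[f nz /eigP fE]].
  exists (vpick (passmx.leigenspace (laplacian T) t)) => //.
  by apply/eigP/memv_pick.
rewrite vpick0; apply: contra_neq nz => E0.
by apply/eqP; rewrite -memv0 -E0.
Qed.

Lemma eigen_coordsP (R : realType) (T : weighted_3cycle R) (t : R) (f : ell R) :
  laplacian T f = t *: f <->
  [/\ T 0 1 * (f 0 - f 1) + T 0 2 * (f 0 - f 2) = t * f 0 :> R,
      T 0 1 * (f 1 - f 0) + T 1 2 * (f 1 - f 2) = t * f 1 :> R &
      T 0 2 * (f 2 - f 0) + T 1 2 * (f 2 - f 1) = t * f 2 :> R].
Proof.
have e0 : laplacian T f 0 = _ :> R := @laplacianE _ T f 0 1 2 isT.
have e1 : laplacian T f 1 = _ :> R := @laplacianE _ T f 1 0 2 isT.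
have e2 : laplacian T f 2 = _ :> R := @laplacianE _ T f 2 0 1 isT.
rewrite (weight_sym T 1 0) in e1.
rewrite (weight_sym T 2 0) (weight_sym T 2 1) in e2.
rewrite -e0 -e1 -e2; split=> [->|[E0 E1 E2]]; first by rewrite !ffunE.
apply/ffunP => x; rewrite [RHS]ffunE.
case: x => [[|[|[|//]]] ltx];
  [rewrite (_ : Ordinal ltx = 0)|rewrite (_ : Ordinal ltx = 1)
  |rewrite (_ : Ordinal ltx = 2)] => //; exact: val_inj.
Qed.

(** The positive eigenvalues are the positive roots of the cofactor of [t] in
    the characteristic polynomial. *)
Lemma multiplicity_gt0 (R : realType) (T : weighted_3cycle R) (t : R) :
  0 < t ->
  (0 < multiplicity T t)%N <->
  t ^+ 2 - 2 * weight_sum T * t + 3 * weight_sum2 T = 0.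
Proof.
move=> t0; rewrite multiplicity_gt0_eigenvector /weight_sum /weight_sum2.
split=> [[f nz /eigen_coordsP]|].
  have {nz}: (f 0 : R) != 0 \/ (f 1 : R) != 0 \/ (f 2 : R) != 0.
    have [f0|] := eqVneq (f 0 : R) 0; last by left.
    have [f1|] := eqVneq (f 1 : R) 0; last by right; left.
    right; right; apply: contra_neq nz => f2; apply/ffunP => x; rewrite ffunE.
    by case: x => [[|[|[|//]]] ltx];
      [rewrite -[RHS]f0|rewrite -[RHS]f1|rewrite -[RHS]f2];
      congr (f _); exact: val_inj.
  move: (T 0 1) (T 0 2) (T 1 2) (f 0 : R) (f 1 : R) (f 2 : R).
  move=> a b c x y z nz [E0 E1 E2].
  (* An eigenvector is orthogonal to the constants, which leaves a two by two
     system whose determinant is the quadratic. *)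
  have zE : z = - x - y by apply: (mulfI (lt0r_neq0 t0)); lra.
  subst z; apply/eqP; set q := (X in X == 0).
  have qx : q * x = 0.
    transitivity ((a + 2 * c - t) * (a * (x - y) + b * (x - (- x - y)) - t * x)
      - (b - a) * (a * (y - x) + c * (y - (- x - y)) - t * y)).
      by rewrite /q; ring.
    by rewrite E0 E1 !subrr !mulr0 subrr.
  have qy : q * y = 0.
    transitivity ((a + 2 * b - t) * (a * (y - x) + c * (y - (- x - y)) - t * y)
      - (c - a) * (a * (x - y) + b * (x - (- x - y)) - t * x)).
      by rewrite /q; ring.
    by rewrite E0 E1 !subrr !mulr0 subrr.
  apply: contraT => q0; move/eqP: qx; move/eqP: qy.
  rewrite !mulf_eq0 !(negPf q0) /= => /eqP y0 /eqP x0.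
  by move: nz; rewrite x0 y0 oppr0 addr0 eqxx => -[|[]].
set a := T 0 1; set b := T 0 2; set c := T 1 2 => q0.
have mk (x y : R) :
    (x != 0) || (y != 0) ->
    a * (x - y) + b * (x - (- x - y)) = t * x ->
    a * (y - x) + c * (y - (- x - y)) = t * y ->
    exists2 f, f != 0 & laplacian T f = t *: f.
  move=> nz E0 E1.
  exists [ffun i : 'I_3 => if i == 0 then x else if i == 1 then y else - x - y].
    apply/negP => /eqP /ffunP f0; move: (f0 0) (f0 1) nz.
    by rewrite !ffunE /= => -> ->; rewrite eqxx.
  apply/eigen_coordsP; rewrite !ffunE /= -/a -/b -/c; split=> //.
  lra.
(* The first row of the two by two system determines the eigenvector, unless
   it vanishes; the second row is then [(c - a) * (1, 2)], which kills
   [(2, -1)]. *)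
have [nz|] := boolP ((a - b != 0) || (a + 2 * b - t != 0)).
  by apply: (mk (a - b) (a + 2 * b - t)) => //; lra.
rewrite negb_or !negbK !subr_eq0 => /andP[/eqP ab /eqP tE].
apply: (mk 2 (-1)); first by rewrite pnatr_eq0.
  by rewrite -tE -ab; ring.
by rewrite -tE -ab; ring.
Qed.

(** Vieta's formulas for a quadratic with two positive roots, or a double one,
    known only through its set of positive roots. *)
Lemma vieta_of_pos_roots (R : rcfType) (s p l1 l2 : R) :
  0 < s -> 0 < p -> p <= s ^+ 2 -> 0 < l1 -> 0 < l2 ->
  (forall t, 0 < t -> t ^+ 2 - 2 * s * t + p = 0 <-> t \in [:: l1; l2]) ->
  l1 + l2 = 2 * s /\ l1 * l2 = p.
Proof.
move=> s0 p0 psq l10 l20 rootP.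
have /(rootP _ l10) r1 : l1 \in [:: l1; l2] by rewrite inE eqxx.
have /(rootP _ l20) r2 : l2 \in [:: l1; l2] by rewrite !inE eqxx orbT.
suff sE : l1 + l2 = 2 * s.
  by split=> //; move: r1; rewrite -sE => r1; lra.
have [eql|nel] := eqVneq l1 l2; last first.
  apply: (mulfI (_ : l1 - l2 != 0)); first by rewrite subr_eq0.
  lra.
subst l2; set d := Num.sqrt (s ^+ 2 - p).
have d0 : 0 <= d := sqrtr_ge0 _.
have d2 : d ^+ 2 = s ^+ 2 - p by rewrite sqr_sqrtr ?subr_ge0.
have uniqr t : 0 < t -> t ^+ 2 - 2 * s * t + p = 0 -> t = l1.
  by move=> t0 /(rootP _ t0); rewrite !inE orbb => /eqP.
have rp : s + d = l1.
  by apply: uniqr; [lra|rewrite -[p](subKr (s ^+ 2)) -d2; ring].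
have rm : s - d = l1.
  apply: uniqr; last by rewrite -[p](subKr (s ^+ 2)) -d2; ring.
  by rewrite subr_gt0 -(ltr_pXn2r (_ : 0 < 2)%N) ?nnegrE ?(ltW s0) // d2; lra.
lra.
Qed.

(** * Eigenvalues and global resistance *)

Theorem theorem1 (R : realType) (T : weighted_3cycle R) (l1 l2 : R)
    (l1_gt0 : 0 < l1) (l1_le_l2 : l1 <= l2)
    (l12_spec : forall a : R, 0 < a ->
       multiplicity T a = count_mem a [:: l1; l2]) :
  [/\ l1 * global_resistance T <= 6,
      6 <= l2 * global_resistance T,
      l1 * global_resistance T = 6 <-> equal_weights T &
      l2 * global_resistance T = 6 <-> equal_weights T].
Proof.
have l2_gt0 : 0 < l2 := lt_le_trans l1_gt0 l1_le_l2.
have P0 := weight_sum2_gt0 T.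
have [sumE prodE] : l1 + l2 = 2 * weight_sum T /\ l1 * l2 = 3 * weight_sum2 T.
  apply: vieta_of_pos_roots => //; first exact: weight_sum_gt0.
  - by rewrite mulr_gt0.
  - exact: weight_discriminant_ge0.
  - move=> t t0; rewrite -multiplicity_gt0 // l12_spec //.
    by rewrite -has_count has_pred1.
have eqP12 : equal_weights T <-> l1 = l2.
  have sqE : (l1 - l2) ^+ 2 = 4 * (weight_sum T ^+ 2 - 3 * weight_sum2 T).
    transitivity ((2 * weight_sum T) ^+ 2 - 4 * (3 * weight_sum2 T)).
      by rewrite -sumE -prodE; ring.
    by ring.
  rewrite equal_weightsP; split=> [E|E].
    by apply/eqP; rewrite -subr_eq0 -sqrf_eq0 sqE E subrr mulr0.
  by move: sqE; rewrite E subrr expr0n /= => sqE; lra.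
have rhoE : global_resistance T = 3 * (l1 + l2) / (l1 * l2).
  by rewrite global_resistanceE sumE prodE; field; rewrite gt_eqF.
have l1n0 : l1 != 0 by rewrite gt_eqF.
have l2n0 : l2 != 0 by rewrite gt_eqF.
have E1 : l1 * global_resistance T = 6 - 3 * (l2 - l1) / l2.
  by rewrite rhoE; field; rewrite l2n0.
have E2 : l2 * global_resistance T = 6 + 3 * (l2 - l1) / l1.
  by rewrite rhoE; field; rewrite l1n0.
have gap (l : R) : 0 < l -> 0 <= 3 * (l2 - l1) / l.
  by move=> l0; rewrite divr_ge0 ?mulr_ge0 ?subr_ge0 // ltW.
have gap0 (l : R) : l != 0 -> 3 * (l2 - l1) / l = 0 -> l1 = l2.
  move=> l0 /eqP; rewrite !mulf_eq0 invr_eq0 (negPf l0) pnatr_eq0 orbF /=.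
  by rewrite subr_eq0 => /eqP.
rewrite E1 E2; split.
- by rewrite gerBl gap.
- by rewrite lerDl gap.
- rewrite eqP12; split=> [E|->]; last by rewrite subrr mulr0 mul0r subr0.
  by apply: (gap0 l2) => //; lra.
- rewrite eqP12; split=> [E|->]; last by rewrite subrr mulr0 mul0r addr0.
  by apply: (gap0 l1) => //; lra.
Qed.
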